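(* Let $n\geq 2$. In the prisoners-and-rooms game with $n$ prisoners, $r=2$ rooms and $q=2$ states per room, with both rooms initially in state $0$, the prisoners do not have a winning strategy.
   Context: The game: there are $n$ prisoners and $r$ rooms; each room contains a switch that is in one of $q$ states $\{0,1,\ldots,q-1\}$. The initial state of every room is known to the prisoners. A warden leads prisoners into rooms one at a time according to a schedule, i.e. an infinite sequence of (prisoner, room) pairs; a schedule is valid if every prisoner visits every room infinitely often. The rooms are indistinguishable to the prisoners, and prisoners have no information about time or other visits: on each visit a prisoner observes only the current state of the room, may change it to any state, and may declare that all prisoners have visited all rooms. A (deterministic) strategy assigns to each prisoner a rule determining, from the sequence of states that prisoner has observed so far (and their own previous actions), what new state to set and whether to declare. A strategy is winning if for every valid schedule some prisoner eventually declares, and every declaration is made only at a time when every prisoner has already visited every room. Strategies may differ between prisoners unless stated otherwise. *)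

(* Defs.v *)
From mathcomp Require Import all_boot.
Set Implicit Arguments. Unset Strict Implicit. Unset Printing Implicit Defensive.

(* A deterministic strategy: each prisoner p maps the sequence of states
   he has observed so far (including the current observation, oldest first)
   to the new state to set and whether to declare.  Since the strategy is
   deterministic, the prisoner's own previous actions are a function of his
   previous observations, so they need not be an explicit input. *)
Definition strategy (n q : nat) := 'I_n -> seq 'I_q -> 'I_q * bool.

Definition schedule (n r : nat) := nat -> 'I_n * 'I_r.

Definition valid_schedule (n r : nat) (sched : schedule n r) : Prop :=
  forall (p : 'I_n) (k : 'I_r) (N : nat), exists2 t, N <= t & sched t = (p, k).

Definition config (n r q : nat) := (('I_r -> 'I_q) * ('I_n -> seq 'I_q))%type.

Definition step (n r q : nat) (strat : strategy n q) (c : config n r q)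
    (pk : 'I_n * 'I_r) : config n r q * bool :=
  let p := pk.1 in let k := pk.2 in
  let h := rcons (c.2 p) (c.1 k) in
  let a := strat p h in
  ((fun k' => if k' == k then a.1 else c.1 k',
    fun p' => if p' == p then h else c.2 p'), a.2).

Fixpoint conf (n r q : nat) (init : 'I_r -> 'I_q) (strat : strategy n q)
    (sched : schedule n r) (t : nat) : config n r q :=
  match t with
  | 0 => (init, fun _ => [::])
  | t'.+1 => (step strat (conf init strat sched t') (sched t')).1
  end.

Definition declares (n r q : nat) (init : 'I_r -> 'I_q) (strat : strategy n q)
    (sched : schedule n r) (t : nat) : bool :=
  (step strat (conf init strat sched t) (sched t)).2.

Definition all_visited (n r : nat) (sched : schedule n r) (t : nat) : Prop :=
  forall (p : 'I_n) (k : 'I_r), exists2 t', t' <= t & sched t' = (p, k).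

Definition winning (n r q : nat) (init : 'I_r -> 'I_q) (strat : strategy n q) : Prop :=
  forall sched : schedule n r, valid_schedule sched ->
    (exists t, declares init strat sched t) /\
    (forall t, declares init strat sched t -> all_visited sched t).

(* Main.v *)
Require Import Defs.
From mathcomp Require Import all_boot.
From Stdlib Require Import Classical ClassicalEpsilon.
Set Implicit Arguments. Unset Strict Implicit. Unset Printing Implicit Defensive.

(** A prisoner cannot declare as long as his view (the sequence of states he has
    observed) also occurs in a run in which some prisoner has missed some room.
    The warden therefore looks for an infinite valid schedule along which every
    view remains of this kind.

    As long as both rooms are in state 0 between excursions that stay inside one
    room, all views also occur in a run confined to room 0.  If p sets a room to
    1 and someone sets it back when shown 1s only, the warden can go on like
    this forever.  Otherwise a run confined to room 0 reaches a position Sigma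
    with states (1, 0) in which nobody ever reacts to seeing 1s only.

    After Sigma the warden keeps every view equal to one arising when its owner
    moves alone after Sigma, the others never having seen room 1.  From states
    (1, 0), a prisoner who flips a room makes both states equal to some v; if he
    is then shown v until he flips the same room back, the states are (1, 0)
    again and the others notice nothing.  This fails only if some solo run ends
    with both states equal to v and its player never reacting to v again.  If
    this happens with v = 1, all prisoners are insensitive to 1s and the game is
    frozen.  If it happens with v = 0 but not with v = 1, the game stays at
    (0, 0), except for excursions of the other prisoners to a state 1, from which
    they all return. *)

Lemma recurrent_enumeration (T : finType) (x0 : T) :
  exists f : nat -> T, forall x N, exists2 t, N <= t & f t = x.
Proof.
exists (fun t => nth x0 (enum T) (t %% #|T|)) => x N.
have xT : index x (enum T) < #|T| by rewrite cardE index_mem mem_enum.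
exists (N * #|T| + index x (enum T)).
  by apply: leq_trans (leq_addr _ _); rewrite leq_pmulr // (leq_trans _ xT).
by rewrite modnMDl modn_small // nth_index ?mem_enum.
Qed.

(** * Finite runs, views and evading schedules *)

Section Runs.
Variables (n r q : nat) (init : 'I_r -> 'I_q) (strat : strategy n q).
Implicit Types (l e : seq ('I_n * 'I_r)) (m : 'I_n * 'I_r) (p b : 'I_n).
Implicit Types (k : 'I_r) (h : seq 'I_q).

Definition run l : config n r q :=
  foldl (fun c m => (step strat c m).1) (init, fun _ => [::]) l.

Definition rooms l : 'I_r -> 'I_q := (run l).1.
Definition view l p : seq 'I_q := (run l).2 p.
Definition answer p h : 'I_q := (strat p h).1.

Lemma rooms_rcons l p k k' :
  rooms (rcons l (p, k)) k' =
  if k' == k then answer p (rcons (view l p) (rooms l k)) else rooms l k'.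
Proof. by rewrite /rooms /run foldl_rcons. Qed.

Lemma view_rcons l m p :
  view (rcons l m) p =
  if p == m.1 then rcons (view l p) (rooms l m.2) else view l p.
Proof.
by rewrite /view /run foldl_rcons /=; case: eqP => // ->.
Qed.

Lemma conf_run (sched : schedule n r) t :
  conf init strat sched t = run (mkseq sched t).
Proof.
by elim: t => //= t IH; rewrite IH /run mkseqS foldl_rcons.
Qed.

Lemma declares_view (sched : schedule n r) t :
  declares init strat sched t =
  (strat (sched t).1 (view (mkseq sched t.+1) (sched t).1)).2.
Proof.
by rewrite /declares conf_run mkseqS view_rcons eqxx.
Qed.

Lemma view_cat l e p : exists h, view (l ++ e) p = view l p ++ h.
Proof.
elim/last_ind: e => [|e m [h IH]]; first by exists [::]; rewrite !cats0.
rewrite -rcons_cat view_rcons IH; case: eqP => _; last by exists h.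
by exists (rcons h (rooms (l ++ e) m.2)); rewrite rcons_cat.
Qed.

Lemma view_split l p h x h' :
    view l p = rcons h x ++ h' ->
  exists l1 k l2,
    [/\ l = l1 ++ (p, k) :: l2, view l1 p = h & rooms l1 k = x].
Proof.
elim/last_ind: l h' => [|l [p' k] IH] h'; first by case: h.
have keep h2 : view l p = rcons h x ++ h2 -> exists l1 k' l2,
   [/\ rcons l (p', k) = l1 ++ (p, k') :: l2, view l1 p = h & rooms l1 k' = x].
  by case/IH=> l1 [k' [l2 [-> Eh Ex]]]; exists l1, k', (rcons l2 (p', k)); rewrite rcons_cat.
rewrite view_rcons /=; case: eqP => [Ep | _]; last exact: keep.
subst p'.
elim/last_ind: h' => [|h' y _].
  rewrite cats0 => /rcons_inj[<- <-].
  by exists l, k, [::]; rewrite cats1.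
by rewrite -rcons_cat => /rcons_inj[+ _]; apply: keep.
Qed.

(** The run [l] may differ from the one actually played: only the view of [p] has to agree. *)
Definition blind p h : Prop :=
  exists l b k, (b, k) \notin l /\ view l p = h.

(** In a schedule that starts with the witness run [l], the view [rcons h x] occurs inside [l], when
    [(b, k0)] has not been played yet. *)
Lemma blind_silent p h x h' :
  winning init strat -> blind p (rcons h x ++ h') ->
  ~~ (strat p (rcons h x)).2.
Proof.
move=> win [l [b [k0 [bl /view_split[l1 [k [l2 [El Eh Ex]]]]]]]].
have [f fP] := recurrent_enumeration (b, k0).
(* After the end of [l] the default value [f t] takes over and makes the schedule valid. *)
pose s : schedule n r := fun t => nth (f t) l t.
have s_valid : valid_schedule s.
  move=> p' k' N; have [t] := fP (p', k') (maxn N (size l)).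
  by rewrite geq_max => /andP[Nt lt] <-; exists t; rewrite // /s nth_default.
have [_ safe] := win s s_valid; apply/negP => dec.
have size_l1 : size l1 < size l by rewrite El size_cat /= addnS ltnS leq_addr.
have s1 : s (size l1) = (p, k) by rewrite /s El nth_cat ltnn subnn.
have mk1 : mkseq s (size l1) = l1.
  apply: (@eq_from_nth _ (b, k0)); rewrite size_mkseq // => u ul.
  by rewrite nth_mkseq // /s El nth_cat ul (set_nth_default (b, k0)).
have /safe/(_ b k0)[t t_le st] : declares init strat s (size l1).
  by rewrite declares_view mkseqS mk1 s1 view_rcons eqxx Eh Ex.
by case/negP: bl; rewrite -st mem_nth // (leq_ltn_trans t_le).
Qed.

(** Inserting the moves of a recurrent enumeration one by one makes the runs in [P] grow to a valid
    schedule. Every view along it is a prefix of a blind one, so nobody declares. *)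
Lemma evasion (m0 : 'I_n * 'I_r) (P : seq ('I_n * 'I_r) -> Prop) l0 :
    P l0 -> (forall l p, P l -> blind p (view l p)) ->
    (forall l m, P l -> exists e, P (l ++ m :: e)) ->
  ~ winning init strat.
Proof.
move=> Pl0 Pblind Pnext win.
have [f fP] := recurrent_enumeration m0.
have next (u : {l | P l}) m : {v : {l | P l} | exists e, sval v = sval u ++ m :: e}.
  apply: constructive_indefinite_description; case: u => l Pl /=.
  by have [e Pe] := Pnext l m Pl; exists (exist _ _ Pe), e.
pose L := fix L t := if t is t'.+1 then sval (next (L t') (f t')) else exist P l0 Pl0.
have LS t : exists e, sval (L t.+1) = sval (L t) ++ f t :: e by exact: svalP (next _ _).
have L_mono i j : i <= j -> exists e, sval (L j) = sval (L i) ++ e.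
  move/subnKC <-; elim: (j - i) => [|d [e IH]].
    by rewrite addn0; exists [::]; rewrite cats0.
  by have [e'] := LS (i + d); rewrite addnS IH -catA => ->; eexists.
have L_size t : t <= size (sval (L t)).
  elim: t => // t IH; have [e ->] := LS t.
  by rewrite size_cat /= addnS ltnS (leq_trans IH) ?leq_addr.
(* [L t.+1] has more than [t] moves, so the default [m0] is never reached. *)
pose s : schedule n r := fun t => nth m0 (sval (L t.+1)) t.
have sE t j : t < size (sval (L j)) -> s t = nth m0 (sval (L j)) t.
  move=> tj; rewrite /s; case: (leqP t.+1 j) => [/L_mono[e Ej] | /ltnW/L_mono[e ->]].
    by rewrite Ej nth_cat L_size.
  by rewrite nth_cat tj.
have s_mk t j : t <= size (sval (L j)) -> mkseq s t = take t (sval (L j)).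
  move=> tj; apply: (@eq_from_nth _ m0); rewrite size_mkseq ?size_takel // => u ut.
  by rewrite nth_mkseq // nth_take // (sE _ j) // (leq_trans ut).
have s_valid : valid_schedule s.
  move=> p k N; have [t Nt ft] := fP (p, k) N.
  exists (size (sval (L t))); first exact: leq_trans (L_size t).
  have [e Ee] := LS t.
  rewrite (sE _ t.+1) Ee; first by rewrite nth_cat ltnn subnn.
  by rewrite size_cat /= addnS ltnS leq_addr.
have [[t dec] _] := win s s_valid; move: dec; apply/negP.
have view_s := s_mk _ _ (L_size t.+1).
have := Pblind _ (s t).1 (svalP (L t.+1)).
rewrite -(cat_take_drop t.+1 (sval (L t.+1))) -view_s.
have [h ->] := view_cat (mkseq s t.+1) (drop t.+1 (sval (L t.+1))) (s t).1.
rewrite declares_view mkseqS view_rcons eqxx.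
exact: blind_silent.
Qed.

Definition stuck p h v : Prop := forall j, answer p (h ++ nseq j.+1 v) = v.

Lemma stuck_rcons p h v : stuck p h v -> stuck p (rcons h v) v.
Proof. by move=> st j; rewrite cat_rcons; apply: (st j.+1). Qed.

(* The room [k] is the same for the whole burst, so its observations only
   depend on the prisoner's view: one [j] serves all runs with that view. *)
Lemma unstuck_burst p h v :
  ~ stuck p h v -> exists j, forall l k, view l p = h -> rooms l k = v ->
  let l' := l ++ nseq j.+1 (p, k) in
  [/\ rooms l' k != v, forall k', k' != k -> rooms l' k' = rooms l k',
      view l' p = h ++ nseq j.+1 v & forall b, b != p -> view l' b = view l b].
Proof.
move=> nst; have ex : exists j, answer p (h ++ nseq j.+1 v) != v.
  by apply: NNPP => none; apply: nst => j; apply/eqP/negPn/negP => ?; apply: none; exists j.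
case: (ex_minnP ex) => j flip j_min {nst ex}; exists j => l k lh lv.
have nseqSr i (T : Type) (x : T) : nseq i.+1 x = rcons (nseq i x) x by elim: i => //= i <-.
(* By minimality of [j], the first [j] moves leave the rooms unchanged. *)
have before i : i <= j -> [/\ rooms (l ++ nseq i (p, k)) =1 rooms l,
    view (l ++ nseq i (p, k)) p = h ++ nseq i v &
    forall b, b != p -> view (l ++ nseq i (p, k)) b = view l b].
  elim: i => [|i IH] ij; first by rewrite !cats0.
  have [IHr IHp IHb] := IH (ltnW ij).
  rewrite (nseqSr i _ (p, k)) -rcons_cat; split=> [k'||b bp].
  - rewrite rooms_rcons IHp IHr lv rcons_cat -nseqSr; case: eqP => // ->.
    by rewrite lv; apply/eqP/negPn/negP => /j_min; rewrite leqNgt ij.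
  - by rewrite view_rcons eqxx IHp IHr lv rcons_cat -nseqSr.
  - by rewrite view_rcons (negPf bp) IHb.
have [jr jp jb] := before j (leqnn j).
move=> l'; rewrite {}/l' (nseqSr j _ (p, k)) -rcons_cat.
split=> [|k' kk'||b bp].
- by rewrite rooms_rcons eqxx jp jr lv rcons_cat -nseqSr.
- by rewrite rooms_rcons (negPf kk') jr.
- by rewrite view_rcons eqxx jp jr lv rcons_cat -nseqSr.
- by rewrite view_rcons (negPf bp) jb.
Qed.

End Runs.

Lemma ord2_neq (x v w : 'I_2) : v != w -> x != v -> x = w.
Proof.
by case: x v w => [[|[|//]] ?] [[|[|//]] ?] [[|[|//]] ?] // _ _; apply/val_inj.
Qed.

(** * Two rooms with two states, and solo runs *)

Section TwoRooms.
Variables (n : nat) (hn : 2 <= n) (strat : strategy n 2).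

Local Notation off := (ord0 : 'I_2).
Local Notation on := (ord_max : 'I_2).
Local Notation init := (fun _ : 'I_2 => off).
Local Notation rooms := (rooms init strat).
Local Notation view := (view init strat).
Local Notation answer := (answer strat).
Local Notation stuck := (stuck strat).
Local Notation blind := (blind init strat).
Local Notation move := ('I_n * 'I_2)%type.

Lemma other_prisoner (p : 'I_n) : exists b : 'I_n, b != p.
Proof.
case: (altP (Ordinal hn =P p)) => [<-|ne]; last by exists (Ordinal hn).
by exists (Ordinal (ltnW hn)).
Qed.

Definition room0_only (l : seq move) := all (fun m => m.2 == ord0) l.

Lemma room0_only_off l : room0_only l -> rooms l ord_max = off.
Proof.
elim/last_ind: l => // l [p k] IH.
by rewrite /room0_only all_rcons => /andP[/eqP/= -> l0]; rewrite rooms_rcons IH.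
Qed.

Definition solo l0 p (rho : 'I_2 -> 'I_2) h : Prop := exists2 m : seq move,
  all (fun x => x.1 == p) m & rooms (l0 ++ m) =1 rho /\ view (l0 ++ m) p = h.

(** [l0] avoids room 1 and only [p] moves after it, so any other prisoner has missed room 1. *)
Lemma solo_blind l0 p rho h : room0_only l0 -> solo l0 p rho h -> blind p h.
Proof.
move=> l00 [m mp [_ <-]]; have [b bp] := other_prisoner p.
exists (l0 ++ m), b, ord_max; split=> //.
rewrite mem_cat negb_or; apply/andP; split.
  by apply/negP => /(allP l00).
by apply/negP => /(allP mp); rewrite /= (negPf bp).
Qed.

Lemma solo_step l0 p rho h k : solo l0 p rho h ->
  solo l0 p (fun k' => if k' == k then answer p (rcons h (rho k)) else rho k')
    (rcons h (rho k)).
Proof.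
move=> [m mp [mr mh]]; exists (rcons m (p, k)); first by rewrite all_rcons eqxx.
rewrite -rcons_cat; split; last by rewrite view_rcons eqxx mr mh.
by move=> k'; rewrite rooms_rcons !mr mh.
Qed.

Definition absorbed l0 v : Prop :=
  exists p h, solo l0 p (fun=> v) h /\ stuck p h v.

(** * Play after a run in room 0 that ends with states (1, 0) *)

Section Base.
Variables (l0 : seq move) (l00 : room0_only l0) (l0on : rooms l0 ord0 = on).

Let l0off : rooms l0 ord_max = off := room0_only_off l00.

Lemma base_rooms k k' : k != k' -> rooms l0 k != rooms l0 k'.
Proof.
have [-> ne | k0] := eqVneq k ord0.
  by rewrite (@ord2_neq k' ord0 ord_max) // ?l0on ?l0off // eq_sym.
rewrite (@ord2_neq k ord0 ord_max) // => ne.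
by rewrite (@ord2_neq k' ord_max ord0) ?l0on ?l0off // eq_sym.
Qed.

(** The first answer either keeps [v] or makes both solo states [w]; then, as [p] is not absorbed at
    [w], a burst of visits flips the room back. Answers depend on the view only, so the same burst
    serves every [l] and [k]. *)
Lemma solo_trip p h v w k0 :
    rooms l0 k0 = v -> v != w -> ~ absorbed l0 w -> solo l0 p (rooms l0) h ->
  exists j h', solo l0 p (rooms l0) h' /\
  forall l k, view l p = h -> rooms l k = v ->
  let l' := l ++ nseq j.+1 (p, k) in
  [/\ rooms l' =1 rooms l, view l' p = h' &
      forall b, b != p -> view l' b = view l b].
Proof.
move=> k0v vw nabs ph; have := solo_step k0 ph; rewrite k0v.
have [ans ph'|ans ph'] := eqVneq (answer p (rcons h v)) v.
  exists 0, (rcons h v); split=> [|l k lh lk].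
    have [m mp [mr mh]] := ph'; exists m => //; split=> // k'.
    by rewrite mr ans; case: eqP => // ->.
  rewrite /= cats1; split=> [k'||b bp].
  - by rewrite rooms_rcons lh lk ans; case: eqP => // ->.
  - by rewrite view_rcons eqxx lh lk.
  - by rewrite view_rcons (negPf bp).
have answ : answer p (rcons h v) = w by apply: ord2_neq ans.
have nst : ~ stuck p (rcons h v) w.
  move=> st; apply: nabs; exists p, (rcons h v); split=> //.
  have [m mp [mr mh]] := ph'; exists m => //; split=> // k'.
  (* The room other than [k0] was in state [w] from the start. *)
  rewrite mr answ; case: eqVneq => // /base_rooms.
  by rewrite k0v => /(ord2_neq vw).
have [j jP] := unstuck_burst init nst.
have [m mp [mr mh]] := ph'.
have [|jk jr jp jb] := jP _ k0 mh; first by rewrite mr eqxx.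
exists j.+1, (rcons h v ++ nseq j.+1 w); split=> [|l k lh lk].
  exists (m ++ nseq j.+1 (p, k0)); first by rewrite all_cat mp all_nseq eqxx orbT.
  rewrite catA; split=> // k'; have [->|ne] := eqVneq k' k0.
    by rewrite k0v; apply: ord2_neq jk; rewrite eq_sym.
  by rewrite jr // mr (negPf ne).
have [||ek er ep eb] := jP (rcons l (p, k)) k.
- by rewrite view_rcons eqxx lh lk.
- by rewrite rooms_rcons eqxx lh lk.
move=> l'; rewrite {}/l' -[nseq j.+2 _]/((p, k) :: nseq j.+1 (p, k)) -cat_rcons; split=> [k'||b bp] //.
  have [->|ne] := eqVneq k' k; first by rewrite lk; apply: ord2_neq ek; rewrite eq_sym.
  by rewrite er // rooms_rcons (negPf ne).
by rewrite eb // view_rcons (negPf bp).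
Qed.

(* Once both rooms are in state [v], a prisoner is either insensitive to [v] or
   still follows a solo run from [l0] that stands at [rooms l0], where a visit to
   [k0] shows him the same state [v]. *)
Lemma absorbed_evasion v w k0 l :
    rooms l0 k0 = v -> v != w -> rooms l =1 (fun=> v) ->
    (forall p, (stuck p (view l p) v /\
                exists rho k, rho k = v /\ solo l0 p rho (view l p)) \/
               (~ absorbed l0 w /\ solo l0 p (rooms l0) (view l p))) ->
  ~ winning init strat.
Proof.
move=> k0v vw lv lP.
pose P l := rooms l =1 (fun=> v) /\
  (forall p, (stuck p (view l p) v /\
                exists rho k, rho k = v /\ solo l0 p rho (view l p)) \/
               (~ absorbed l0 w /\ solo l0 p (rooms l0) (view l p))).
apply: (@evasion _ _ _ init strat (Ordinal hn, ord0) P l) => //.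
  by move=> {lv lP} l p [_ /(_ p)[[_ [rho [k [_ /solo_blind]]]]|[_ /solo_blind]]]; apply.
move=> {lv lP} l [p k] [lv lP]; case: (lP p) => [[st [rho [k1 [k1v pl]]]]|[nabs pl]].
  have ans := st 0; rewrite /= cats1 in ans.
  exists [::]; rewrite cats1; split=> [k'|b].
    by rewrite rooms_rcons !lv ans; case: ifP.
  rewrite view_rcons /= lv; case: eqP => [->|_]; last exact: lP.
  left; split; first exact: stuck_rcons.
  (* The solo run reproduces the observation [v] by a visit to [k1]. *)
  have := solo_step k1 pl; rewrite k1v => pl'.
  by eexists _, k1; split; last exact: pl'; rewrite /= eqxx.
have [j [h' [ph' /(_ l k erefl (lv k))[er ep eb]]]] := solo_trip k0v vw nabs pl.
exists (nseq j (p, k)); split=> [k'|b]; first by rewrite er lv.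
by have [->|bp] := eqVneq b p; [right; rewrite ep | rewrite eb].
Qed.

Lemma unabsorbed_evasion :
  (forall v, ~ absorbed l0 v) -> ~ winning init strat.
Proof.
move=> nabs.
pose P l := rooms l =1 rooms l0 /\ forall p, solo l0 p (rooms l0) (view l p).
apply: (@evasion _ _ _ init strat (Ordinal hn, ord0) P l0).
- by split=> // p; exists [::] => //; rewrite cats0.
- by move=> l p [_ /(_ p)/solo_blind]; apply.
move=> l [p k] [lr lP].
have [w vw] : exists w, rooms l0 k != w.
  by have [->|ne] := eqVneq (rooms l0 k) on; [exists off | exists on].
have [j [h' [ph' /(_ l k erefl (lr k))[er ep eb]]]] :=
  solo_trip erefl vw (nabs w) (lP p).
exists (nseq j (p, k)); split=> [k'|b]; first by rewrite er lr.
by have [->|bp] := eqVneq b p; [rewrite ep | rewrite eb].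
Qed.

Lemma stuck_base_evasion :
  (forall p, stuck p (view l0 p) on) -> ~ winning init strat.
Proof.
move=> st.
have base_solo p : solo l0 p (rooms l0) (view l0 p).
  by exists [::] => //; rewrite cats0.
have rest m p b : all (fun x : move => x.1 == p) m -> b != p -> view (l0 ++ m) b = view l0 b.
  move=> + bp; elim/last_ind: m => [|m x IH]; first by rewrite cats0.
  rewrite all_rcons => /andP[/eqP xp /IH<-].
  by rewrite -rcons_cat view_rcons xp (negPf bp).
have [[z [h [[m mz [mr mh]] zst]]]|nabs1] := classic (absorbed l0 on).
  apply: (@absorbed_evasion on off ord0 (l0 ++ m)) => // p; left.
  have [->|pz] := eqVneq p z.
    by rewrite mh; split=> //; exists (fun=> on), ord0; split=> //; exists m.
  by rewrite (rest _ z) //; split=> //; exists (rooms l0), ord0.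
(* With absorption at 1 excluded by [nabs1], prisoners other than [z] return from every excursion to
   1. *)
have [[z [h [[m mz [mr mh]] zst]]]|nabs0] := classic (absorbed l0 off).
  apply: (@absorbed_evasion off on ord_max (l0 ++ m)) => // p.
  have [->|pz] := eqVneq p z; [left | right; last by rewrite (rest _ z)].
  by rewrite mh; split=> //; exists (fun=> off), ord0; split=> //; exists m.
apply: unabsorbed_evasion => v; have [->//|ne] := eqVneq v on.
by rewrite (@ord2_neq v on off).
Qed.

End Base.

(** A shadow run [l0] copies each move into room 0. A flip to 1 is undone in the same room by an
    unstuck [z], with one burst length for both runs, so all views keep agreeing. *)
Lemma room0_evasion :
    (forall l0, room0_only l0 -> rooms l0 ord0 = on ->
       exists p, ~ stuck p (view l0 p) on) ->
  ~ winning init strat.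
Proof.
move=> unst.
pose P l := rooms l =1 (fun=> off) /\ exists2 l0, room0_only l0 &
  rooms l0 ord0 = off /\ forall p, view l p = view l0 p.
apply: (@evasion _ _ _ init strat (Ordinal hn, ord0) P [::]).
- by split=> //; exists [::].
- move=> l p [_ [l0 l00 [_ ->]]]; apply: (@solo_blind l0 p (rooms l0)) => //.
  by exists [::] => //; rewrite cats0.
move=> l [p k] [lr [l0 l00 [l0r lv]]].
have l00' : room0_only (rcons l0 (p, ord0)) by rewrite /room0_only all_rcons.
have lv' b : view (rcons l (p, k)) b = view (rcons l0 (p, ord0)) b.
  by rewrite !view_rcons !lv lr l0r.
have [ans|ans] := eqVneq (answer p (rcons (view l0 p) off)) off.
  exists [::]; rewrite cats1; split=> [k'|].
    by rewrite rooms_rcons lr lv ans lr; case: ifP.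
  by exists (rcons l0 (p, ord0)); rewrite // rooms_rcons l0r ans eqxx.
have ans1 : answer p (rcons (view l0 p) off) = on by apply: ord2_neq ans.
have r0 : rooms (rcons l0 (p, ord0)) ord0 = on by rewrite rooms_rcons l0r ans1 eqxx.
have [z /(unstuck_burst init)[j jP]] := unst _ l00' r0.
have [ek er ep eb] := jP _ _ erefl r0.
have [|ek' er' ep' eb'] := jP _ k (lv' z).
  by rewrite rooms_rcons eqxx lr lv ans1.
exists (nseq j.+1 (z, k)); rewrite -cat_rcons; split=> [k'|].
  have [->|ne] := eqVneq k' k; first exact: ord2_neq ek'.
  by rewrite er' // rooms_rcons (negPf ne) lr.
exists (rcons l0 (p, ord0) ++ nseq j.+1 (z, ord0)).
  by rewrite /room0_only all_cat all_nseq eqxx orbT andbT.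
split=> [|b]; first exact: ord2_neq ek.
by have [->|bz] := eqVneq b z; [rewrite ep ep' | rewrite eb // eb'].
Qed.

End TwoRooms.

Theorem theorem1 (n : nat) (hn : 2 <= n) :
  ~ exists strat : strategy n 2, winning (fun _ : 'I_2 => (ord0 : 'I_2)) strat.
Proof.
case=> strat win; apply: (room0_evasion hn _ win) => l0 l00 l0on.
(* If nobody is unstuck after [l0], then [l0] is the position Sigma. *)
apply: NNPP => none; apply: (stuck_base_evasion hn l00 l0on _ win) => p.
by apply: NNPP => nst; apply: none; exists p.
Qed.
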